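(* Let $k\geq 3$ be an integer and let $\varepsilon>0$. Then there exists $\delta>0$ such that for all sufficiently large $n$ the following holds: if $G$ is an edge-colored graph on $n$ vertices with $e(G)+c(G)\geq \left(1+\frac{k-3}{k-2}+2\varepsilon\right)\binom{n}{2}$, then $G$ contains at least $\delta n^k$ rainbow cliques $K_k$.
   Context: All graphs are finite, simple and undirected. An edge-colored graph is a graph together with an arbitrary (not necessarily proper) assignment of a color to each edge. For an edge-colored graph $G$, $e(G)$ denotes the number of edges of $G$ and $c(G)$ denotes the number of distinct colors appearing on the edges of $G$. A rainbow clique $K_k$ in $G$ is a complete subgraph on $k$ vertices all of whose $\binom{k}{2}$ edges have pairwise distinct colors. *)

(* Defs.v *)
From HB Require Import structures.
From mathcomp Require Import all_boot all_order all_algebra.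
From mathcomp Require Import reals.

Set Implicit Arguments.
Unset Strict Implicit.
Unset Printing Implicit Defensive.

Section EdgeColoredGraphs.

Variable V : finType.

Definition pairs (A : {set V}) : {set {set V}} :=
  [set e : {set V} | (e \subset A) && (#|e| == 2)].

(* An edge is the two-element set of its endpoints, so graphs are simple and
   undirected by construction. The coloring need not be proper; the values of
   [color] on sets that are not edges are never used. *)
Record edge_colored_graph (C : eqType) := EdgeColoredGraph {
  edges : {set {set V}};
  color : {set V} -> C;
  edges_pairs : edges \subset pairs [set: V]
}.

Variable C : eqType.
Variable G : edge_colored_graph C.

Definition num_edges : nat := #|edges G|.

Definition num_colors : nat :=
  size (undup [seq color G e | e in edges G]).

(* A complete subgraph is determined by its vertex set, so cliques are
   represented, and counted, as vertex sets. *)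
Definition rainbow_clique (k : nat) (K : {set V}) : bool :=
  [&& #|K| == k, pairs K \subset edges G & dinjectiveb (color G) (pairs K)].

Definition num_rainbow_cliques (k : nat) : nat :=
  #|[set K : {set V} | rainbow_clique k K]|.

End EdgeColoredGraphs.

(* Main.v *)
(* Choose one representative edge for each color, and give a pair of vertices
   weight 2 if it is a representative edge, 1 if it is another edge and 0
   otherwise, so that the total weight is at least e(G) + c(G). A vertex set S
   maximizing (weight of S) - a |S|(|S| + 1), for a suitable a, has linear size
   and minimum weighted degree at least a |S|. Inside S one can greedily, in
   linearly many ways at each step, build k - 1 vertices with all pairs of
   weight 2, and then add one more vertex losing at most 1 in weight. This
   yields of order n^k k-sets missing at most one representative edge, of which
   only O(n^(k-1)) are not rainbow. *)

Require Import Defs.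
From HB Require Import structures.
From mathcomp Require Import all_boot all_order all_algebra.
From mathcomp Require Import reals.
From mathcomp Require Import zify lra.
Import Order.TTheory GRing.Theory Num.Theory.
Local Open Scope ring_scope.

Set Implicit Arguments.
Unset Strict Implicit.
Unset Printing Implicit Defensive.

(** * Double counting of one-vertex extensions *)

(** For a fixed [v], the map sending [K] to [v |: K] is injective on the sets avoiding [v], and its
    values in [B] contain [v]. Summing over [v] counts each member of [B] once per element, hence at
    most [m] times. *)
Lemma extension_count (V : finType) (A B : {set {set V}}) (m : nat) :
  (forall K, K \in B -> #|K| <= m)%N ->
  (\sum_(K in A) #|[set v | (v \notin K) && (v |: K \in B)]| <= m * #|B|)%N.
Proof.
move=> Bm; apply: (@leq_trans (\sum_(K in B) #|K|)%N); last first.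
  by rewrite mulnC -sum_nat_const; apply: leq_sum.
have swap (F : {set {set V}}) (P : {set V} -> {set V}) :
    (\sum_(K in F) #|P K| = \sum_v #|[set K in F | v \in P K]|)%N.
  transitivity (\sum_(K in F) \sum_v (v \in P K))%N.
    apply: eq_bigr => K _; rewrite -sum1_card big_mkcond.
    by apply: eq_bigr => v _; case: (v \in P K).
  rewrite exchange_big; apply: eq_bigr => v _.
  rewrite -sum1_card big_mkcond [RHS]big_mkcond; apply: eq_bigr => K _.
  by rewrite inE; case: (K \in F); case: (v \in P K).
rewrite (swap A (fun K => [set v | (v \notin K) && (v |: K \in B)])).
rewrite (swap B id); apply: leq_sum => v _.
rewrite -(@card_in_imset _ _ (fun K : {set V} => v |: K)); last first.
  move=> K1 K2; rewrite !inE => /and3P[_ vK _] /and3P[_ vL _] KL.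
  by rewrite -(setU1K vK) KL setU1K.
apply/subset_leq_card/subsetP => _ /imsetP[K + ->]; rewrite !inE => /and3P[_ _ KB].
by rewrite KB eqxx.
Qed.

(** * Weights on pairs and sets of large minimum degree *)

Section WeightedPairs.

Context (V : finType) (w : V -> V -> nat).
Hypothesis w_sym : forall x y, w x y = w y x.
Hypothesis w_irr : forall x, w x x = 0%N.
Hypothesis w_le2 : forall x y, (w x y <= 2)%N.

Definition weight (S : {set V}) : nat := (\sum_(x in S) \sum_(y in S) w x y)%N.

Definition degree (S : {set V}) (v : V) : nat := (\sum_(u in S) w u v)%N.

Lemma degree_le (S : {set V}) v : (degree S v <= 2 * #|S|)%N.
Proof. by rewrite mulnC -sum_nat_const; apply: leq_sum. Qed.

Lemma weight_le (S : {set V}) : (weight S <= 2 * #|S| ^ 2)%N.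
Proof.
rewrite (mulnA 2 #|S|) mulnC -sum_nat_const; apply: leq_sum => x _.
by under eq_bigr do rewrite w_sym; apply: degree_le.
Qed.

Lemma weightU1 (v : V) (K : {set V}) : v \notin K -> weight (v |: K) = (weight K + 2 * degree K v)%N.
Proof.
move=> vK; rewrite /weight big_setU1 //= big_setU1 //= w_irr add0n.
have -> : (\sum_(i in K) \sum_(y in v |: K) w i y =
           degree K v + \sum_(i in K) \sum_(y in K) w i y)%N.
  by rewrite -big_split; apply: eq_bigr => i _; rewrite big_setU1.
by under eq_bigr do rewrite w_sym; rewrite -/(degree K v); lia.
Qed.

Lemma degree_mem (K : {set V}) v : v \in K -> (degree K v <= 2 * #|K|.-1)%N.
Proof.
move=> vK; rewrite /degree (big_setD1 v) //= w_irr add0n.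
by apply: leq_trans (degree_le _ _) _; rewrite (cardsD1 v K) vK.
Qed.

Context (R : realType) (a : R).

(* [weight] sums over ordered pairs, so removing v lowers it by twice its degree,
   while |S|(|S| + 1) decreases by 2 |S|: hence the choice of the potential. *)
Lemma exists_dense_subset :
  exists S : {set V},
    (forall v, v \in S -> a * #|S|%:R <= (degree S v)%:R) /\
    (weight [set: V])%:R - a * #|V|%:R * (#|V|%:R + 1) <=
      (weight S)%:R - a * #|S|%:R * (#|S|%:R + 1).
Proof.
pose phi (S : {set V}) : R := (weight S)%:R - a * #|S|%:R * (#|S|%:R + 1).
have [S _ Smax] := @arg_maxP _ R {set V} [set: V] predT phi isT.
exists S; split; last by rewrite -cardsT; apply: Smax.
move=> v vS; have := Smax (S :\ v) isT; rewrite /phi /=.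
have vS' : v \notin S :\ v by rewrite !inE eqxx.
have dS : degree S v = degree (S :\ v) v.
  by rewrite /degree (big_setD1 v) //= w_irr add0n.
have := weightU1 vS'; rewrite setD1K // dS => ->.
rewrite (cardsD1 v S) vS; set s := #|S :\ v|.
rewrite [(weight _ + _)%:R]natrD natrM natrD.
move: (weight _)%:R (degree _ _)%:R (s%:R : R) => W d r; rewrite /= mulr1n.
by lra.
Qed.

(** * Greedy construction of heavy sets *)

Section Extension.

Context (S : {set V}).
Hypothesis S_deg : forall v, v \in S -> a * #|S|%:R <= (degree S v)%:R.

(** Averaging: by the minimum degree in [S], the degrees into [K] sum to at least [#|K| * a * #|S|]
    over [S]. A vertex contributes at most [t], or up to [2 * #|K|] if it is counted on the
    right. *)
Lemma many_extensions (K : {set V}) (t : nat) :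
  K \subset S -> (t <= 2 * #|K|)%N ->
  (#|K|%:R * a - t%:R) * #|S|%:R <=
  (2 * #|K| - t)%:R * #|[set v in S | (t < degree K v)%N]|%:R.
Proof.
move=> KS tK; set P := [set _ in S | _].
have lo : #|K|%:R * a * #|S|%:R <= (\sum_(v in S) degree K v)%N%:R :> R.
  rewrite /degree exchange_big /= natr_sum -mulrA mulr_natl -sumr_const.
  apply: ler_sum => u uK; rewrite (le_trans (S_deg (subsetP KS _ uK))) //.
  by rewrite /degree; under eq_bigr do rewrite w_sym.
suff hi : (\sum_(v in S) degree K v <= t * #|S| + (2 * #|K| - t) * #|P|)%N.
  by move: hi; rewrite -(ler_nat R) natrD !natrM; lra.
have -> : #|P| = (\sum_(v in S) (t < degree K v)%N)%N.
  rewrite -sum1_card big_mkcond [RHS]big_mkcond; apply: eq_bigr => v _.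
  by rewrite inE; case: (v \in S); case: (t < _)%N.
rewrite [(t * _)%N]mulnC -sum_nat_const big_distrr -big_split /=.
apply: leq_sum => v _; have := degree_le K v.
by case: ltnP => /=; lia.
Qed.

Definition heavy_sets (j W : nat) : {set {set V}} :=
  [set K : {set V} | [&& K \subset S, #|K| == j & (W <= weight K)%N]].

Lemma heavy_setsS (c : R) (j t W : nat) :
  (2 * j - 2 <= t < 2 * j)%N -> c * (2 * j - t)%:R <= j%:R * a - t%:R ->
  c * #|S|%:R * #|heavy_sets j W|%:R <=
    j.+1%:R * #|heavy_sets j.+1 (W + 2 * t.+1)|%:R.
Proof.
move=> /andP[t_ge t_lt] hc; set A := heavy_sets j W; set B := heavy_sets j.+1 _.
have Bm K : K \in B -> (#|K| <= j.+1)%N by rewrite inE => /and3P[_ /eqP->].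
have := @extension_count V A B _ Bm.
rewrite -(ler_nat R) natrM; apply: le_trans.
rewrite natr_sum mulr_natr -sumr_const; apply: ler_sum => K.
rewrite inE => /and3P[KS /eqP cK WK].
have := @many_extensions K t KS; rewrite cK => /(_ (ltnW t_lt)) h.
have gap : 0 < (2 * j - t)%:R :> R by rewrite ltr0n subn_gt0.
apply: (@le_trans _ _ #|[set v in S | (t < degree K v)%N]|%:R).
  rewrite -(ler_pM2l gap); apply: le_trans h.
  by rewrite mulrA ler_wpM2r // mulrC.
rewrite ler_nat; apply/subset_leq_card/subsetP => v; rewrite !inE => /andP[vS tv].
have vK : v \notin K.
  (* Inside [K] degrees are at most [2 * j - 2 <= t], so degree above [t] forces a new vertex. *)
  by apply/negP => /degree_mem; rewrite cK; lia.
by rewrite vK subUset sub1set vS KS cardsU1 vK cK eqxx weightU1 //=; lia.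
Qed.

(** The full weight of [j] vertices is [2 * j * (j - 1)]. It is kept up to size [m.+2], and the last
    vertex loses one unit, counted twice. The factorial collects the factors [j.+1] of
    [heavy_setsS]. *)
Lemma many_heavy_sets (c : R) (m : nat) :
  0 <= c -> 2 - m.+1%:R^-1 + 2 * c <= a ->
  c ^+ m.+2 * #|S|%:R ^+ m.+3 <=
    (m.+3)`!%:R * #|heavy_sets m.+3 (2 * m.+3 * m.+2 - 2)|%:R.
Proof.
move=> c0 ha.
have step j t W W' : (0 < j)%N -> (2 * j - 2 <= t < 2 * j)%N ->
    W' = (W + 2 * t.+1)%N -> c * (2 * j - t)%:R <= j%:R * a - t%:R ->
    c ^+ j.-1 * #|S|%:R ^+ j <= j`!%:R * #|heavy_sets j W|%:R ->
    c ^+ j * #|S|%:R ^+ j.+1 <= j.+1`!%:R * #|heavy_sets j.+1 W'|%:R.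
  case: j => // j _ tj -> hc IH.
  rewrite factS natrM -[leRHS]mulrA [X in _ <= X]mulrCA.
  have := heavy_setsS W tj hc; rewrite -(ler_pM2l (_ : 0 < j.+1`!%:R)); last first.
    by rewrite ltr0n fact_gt0.
  apply: le_trans.
  rewrite (exprS c j) (exprS #|S|%:R j.+1) mulrACA [leRHS]mulrCA.
  by rewrite ler_wpM2l // mulr_ge0.
have small j : (j <= m.+1)%N ->
    c ^+ j * #|S|%:R ^+ j.+1 <= j.+1`!%:R * #|heavy_sets j.+1 (2 * j.+1 * j)|%:R.
  elim: j => [|j IH] jm.
    rewrite expr0 mul1r expr1 mul1r ler_nat muln0 -(@card_imset _ _ set1); last exact: set1_inj.
    apply/subset_leq_card/subsetP => _ /imsetP[x xS ->].
    by rewrite inE sub1set xS cards1 eqxx.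
  (* This [t] demands weight 2 to every chosen vertex. The averaging margin is at least
     [1 - j.+1 / m.+1 + 2 * c * j.+1], which suffices as long as [j.+1 <= m.+1]. *)
  apply: (step j.+1 (2 * j.+1).-1 (2 * j.+1 * j)%N _ _ _ _ _ (IH (ltnW jm))); [by []|by lia|by lia|].
  have -> : (2 * j.+1 - (2 * j.+1).-1 = 1)%N by lia.
  have -> : (2 * j.+1).-1%:R = 2 * j.+1%:R - 1 :> R.
    by rewrite -natrM -[in RHS](@prednK (2 * j.+1)%N) ?muln_gt0 // -natr1 addrK.
  have j1 : 1 <= j.+1%:R :> R by rewrite ler1n.
  have jm1 : j.+1%:R * m.+1%:R^-1 <= 1 :> R.
    by rewrite ler_pdivrMr ?ltr0n // mul1r ler_nat.
  move: (j.+1%:R : R) (m.+1%:R^-1 : R) j1 jm1 ha => x y; nra.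
(* At size [m.+2] that margin may be negative, so [t] is lowered by one: one pair of weight 1 is
   tolerated. *)
apply: (step m.+2 (2 * m.+2 - 2)%N (2 * m.+2 * m.+1)%N _ _ _ _ _ (small _ (leqnn _))); [by []|by lia|by lia|].
have -> : (2 * m.+2 - (2 * m.+2 - 2) = 2)%N by lia.
rewrite natrB ?natrM ?leq_pmulr //.
have m0 : 1 <= m.+1%:R :> R by rewrite ler1n.
have m1 : m.+1%:R * m.+1%:R^-1 = 1 :> R by rewrite divff ?pnatr_eq0.
have -> : m.+2%:R = m.+1%:R + 1 :> R by rewrite natr1.
have my : m.+1%:R^-1 <= 1 :> R by rewrite invf_le1 // ltr0n.
have h1 : 0 <= (m.+1%:R + 1) * (a - (2 - m.+1%:R^-1 + 2 * c)).
  by apply: mulr_ge0; [rewrite addr_ge0 | rewrite subr_ge0].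
have h2 : 0 <= m.+1%:R * c by rewrite mulr_ge0.
by move: (m.+1%:R : R) (m.+1%:R^-1 : R) m1 my h1 h2 => x y; lra.
Qed.

End Extension.

Lemma weighted_supersaturation (eps : R) (m : nat) :
  0 < eps -> a = 2 - m.+1%:R^-1 + eps -> 8 + 6 * eps <= eps * #|V|%:R ->
  (a + eps) * (#|V|%:R * (#|V|%:R - 1)) <= (weight [set: V])%:R ->
  (eps / 2) ^+ m.+2 * (eps / 4 * #|V|%:R) ^+ m.+3 <=
    (m.+3)`!%:R *
    #|[set K : {set V} | (#|K| == m.+3) && (2 * m.+3 * m.+2 - 2 <= weight K)%N]|%:R.
Proof.
move=> e0 ha hn hw; have [S [S_deg Sw]] := exists_dense_subset.
have a0 : 0 <= a.
  have : m.+1%:R^-1 <= 1 :> R by rewrite invf_le1 ?ler1n // ltr0n.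
  by rewrite ha; move: (_^-1) => y; lra.
have a2 : a <= 2 + eps.
  by rewrite ha lerD2r gerBl invr_ge0 ler0n.
have sn : #|S|%:R <= #|V|%:R :> R by rewrite ler_nat max_card.
have n0 : 0 < #|V|%:R :> R.
  by rewrite -(pmulr_rgt0 _ e0); apply: lt_le_trans hn; lra.
(* With [n = #|V|], the potential of the whole set is at least [eps * n^2 - (2 * a + eps) * n],
   hence at least [eps * n^2 / 2], while that of [S] is at most [2 * #|S|^2]. Then [#|S| <= n]
   removes the square. *)
have S_large : eps / 4 * #|V|%:R <= #|S|%:R.
  have ws : (weight S)%:R <= 2 * #|S|%:R ^+ 2 :> R.
    by rewrite -natrX -natrM ler_nat weight_le.
  rewrite -(ler_pM2r n0).
  have : eps / 4 * #|V|%:R * #|V|%:R <= #|S|%:R * #|S|%:R.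
    have : 0 <= a * #|S|%:R * (#|S|%:R + 1) by rewrite !mulr_ge0 // addr_ge0.
    move: Sw hw ws; move: (weight _)%:R (weight _)%:R => W W'.
    have h1 : (8 + 6 * eps) * #|V|%:R <= eps * #|V|%:R * #|V|%:R by rewrite ler_wpM2r // ltW.
    have h2 : a * #|V|%:R <= (2 + eps) * #|V|%:R by rewrite ler_wpM2r // ltW.
    move: h1 h2; move: (#|V|%:R : R) (#|S|%:R : R) => n s; lra.
  by move/le_trans; apply; rewrite ler_wpM2l.
have c0 : 0 <= eps / 2 by lra.
have ca : 2 - m.+1%:R^-1 + 2 * (eps / 2) <= a by rewrite ha; move: (m.+1%:R^-1) => y; lra.
have h := many_heavy_sets S_deg c0 ca.
apply: (@le_trans _ _ ((eps / 2) ^+ m.+2 * #|S|%:R ^+ m.+3)).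
  rewrite ler_wpM2l ?exprn_ge0 // lerXn2r ?nnegrE // mulr_ge0 ?(ltW n0) //; lra.
apply: le_trans h _; rewrite ler_wpM2l // ler_nat.
by apply/subset_leq_card/subsetP => K; rewrite !inE => /and3P[_ -> ->].
Qed.

End WeightedPairs.

(** * Counting edges inside a set and supersets of a set *)

Lemma card_pairs (V : finType) (A : {set V}) : #|pairs A| = 'C(#|A|, 2).
Proof. exact: cards_draws. Qed.

Lemma sum_ordered_pairs (V : finType) (E : {set {set V}}) (A : {set V}) :
  E \subset pairs [set: V] ->
  (\sum_(x in A) \sum_(y in A) ([set x; y] \in E) = 2 * #|E :&: pairs A|)%N.
Proof.
move=> Epairs; rewrite pair_big /=.
rewrite mulnC -sum_nat_const.
transitivity (\sum_(p : V * V | [&& p.1 \in A, p.2 \in A & [set p.1; p.2] \in E]) 1)%N.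
  rewrite big_mkcond [RHS]big_mkcond; apply: eq_bigr => -[x y] _ /=.
  by case: (x \in A); case: (y \in A); case: (_ \in E).
(* Ordered pairs are grouped by their underlying set; an edge has two distinct ends, so each fibre
   has two elements. *)
rewrite (partition_big (fun p : V * V => [set p.1; p.2])
  (fun e => e \in E :&: pairs A)) /=; last first.
  move=> [x y] /= /and3P[xA yA xyE]; rewrite !inE xyE subUset !sub1set xA yA /=.
  by have := subsetP Epairs _ xyE; rewrite inE => /andP[].
apply: eq_bigr => e; rewrite !inE => /and3P[eE eA /cards2P[x [y [xy exy]]]].
have xA : x \in A by apply: (subsetP eA); rewrite exy !inE eqxx.
have yA : y \in A by apply: (subsetP eA); rewrite exy !inE eqxx orbT.
rewrite sum1_card -(_ : #|[set (x, y); (y, x)]| = 2)%N; last first.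
  by rewrite cards2 xpair_eqE (negbTE xy).
apply: eq_card => -[u v]; rewrite !inE /= unfold_in /=.
apply/idP/idP; last first.
  by case/orP=> /eqP[-> ->]; rewrite ?xA ?yA /= ?(setUC [set y]) -exy eE eqxx.
case/andP=> _ /eqP uv.
have : u \in [set x; y] by rewrite -exy -uv set21.
have : v \in [set x; y] by rewrite -exy -uv set22.
have : x \in [set u; v] by rewrite uv exy set21.
have : y \in [set u; v] by rewrite uv exy set22.
move=> yuv xuv /set2P[] vE /set2P[] uE; move: xuv yuv; rewrite uE vE ?eqxx ?orbT //.
  by move=> _; rewrite !inE orbb eq_sym (negbTE xy).
by rewrite !inE orbb (negbTE xy).
Qed.

Lemma leq_bin_expn (n j : nat) : ('C(n, j) <= n ^ j)%N.
Proof.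
apply: (@leq_trans ('C(n, j) * j`!)); first by rewrite leq_pmulr // fact_gt0.
rewrite bin_ffact ffact_prod -[j in (_ ^ j)%N]card_ord -prod_nat_const.
by apply: leq_prod => i _; apply: leq_subr.
Qed.

(** A superset [K] of [T] is determined by [K :\: T], a set of [k - #|T|] vertices. *)
Lemma card_supersets (V : finType) (T : {set V}) (j k : nat) :
  (0 < #|V|)%N -> (j <= #|T|)%N ->
  (#|[set K : {set V} | (T \subset K) && (#|K| == k)]| <= #|V| ^ (k - j))%N.
Proof.
move=> V0 jT; rewrite -(@card_in_imset _ _ (fun K : {set V} => K :\: T)); last first.
  move=> K1 K2; rewrite !inE => /andP[T1 _] /andP[T2 _] K12.
  by rewrite -(setID K1 T) -(setID K2 T) K12 (setIidPr T1) (setIidPr T2).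
apply: (@leq_trans 'C(#|V|, k - #|T|)).
  rewrite -card_draws; apply/subset_leq_card/subsetP => _ /imsetP[K + ->].
  by rewrite !inE => /andP[TK /eqP <-]; rewrite cardsD (setIidPr TK).
by rewrite (leq_trans (leq_bin_expn _ _)) // leq_pexp2l // leq_sub2l.
Qed.

(** * Representative edges and non-rainbow cliques *)

Section Representatives.

Context (V : finType) (C : eqType) (G : edge_colored_graph V C).

(** The default can be reached only off the edge set, since an edge is itself a candidate for the
    search. *)
Definition color_rep (e : {set V}) : {set V} :=
  odflt e [pick f in edges G | color G f == color G e].

Definition rep_edges : {set {set V}} := color_rep @: edges G.

Lemma color_repP e : e \in edges G ->
  color_rep e \in edges G /\ color G (color_rep e) = color G e.
Proof.
move=> eE; rewrite /color_rep; case: pickP => [f /andP[fE /eqP]|/(_ e)] //=.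
Qed.

Lemma rep_edges_sub : rep_edges \subset edges G.
Proof. by apply/subsetP => _ /imsetP[e /color_repP[? _] ->]. Qed.

(** Edges of one color define the same search predicate, so [pick] returns the same edge: each color
    has a single representative. *)
Lemma rep_edges_eq e f : e \in edges G -> f \in rep_edges ->
  color G e = color G f -> f = color_rep e.
Proof.
move=> eE /imsetP[g gE ->] ef; rewrite /color_rep.
have [hE hg] := color_repP gE.
have -> : [pick f0 in edges G | color G f0 == color G e] =
          [pick f0 in edges G | color G f0 == color G g].
  by apply: eq_pick => f0; rewrite ef hg.
by case: pickP => [//|/(_ g)]; rewrite gE eqxx.
Qed.

Lemma num_colors_le : (num_colors G <= #|rep_edges|)%N.
Proof.
rewrite /num_colors cardE -(size_map (color G)); apply: uniq_leq_size.
  exact: undup_uniq.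
move=> c; rewrite mem_undup => /imageP[e eE ->]; have [fE <-] := color_repP eE.
by apply: map_f; rewrite mem_enum; apply: imset_f.
Qed.

(* A heavy non-rainbow clique misses one representative edge e, and the
   representative of the color of e also lies in it: these two edges span at
   least three vertices, so they leave at most #|V| ^ (k - 3) cliques. *)
Lemma few_nonrainbow_cliques (k : nat) : (3 <= k)%N -> (0 < #|V|)%N ->
  (#|[set K : {set V} | [&& #|K| == k,
      2 * 'C(k, 2) <= #|edges G :&: pairs K| + #|rep_edges :&: pairs K| + 1 &
      ~~ rainbow_clique G k K]]| <= #|V| ^ k.-1)%N.
Proof.
move=> k3 V0; set bad := [set K | _].
pose T (e : {set V}) := e :|: color_rep e.
pose sup (e : {set V}) := [set K : {set V} | (T e \subset K) && (#|K| == k)].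
pose D := [set e in edges G | e != color_rep e].
have bad_sub : bad \subset \bigcup_(e in D) sup e.
  apply/subsetP => K; rewrite inE => /and3P[Kk heavy].
  rewrite /rainbow_clique Kk /= negb_and.
  have HE : rep_edges :&: pairs K \subset edges G :&: pairs K.
    exact/setSI/rep_edges_sub.
  have cE := subset_leq_card (subsetIr (edges G) (pairs K)).
  have cH := subset_leq_card HE.
  have cK : #|pairs K| = 'C(k, 2) by rewrite card_pairs (eqP Kk).
  (* A pair that is no edge is no representative either and would cost two units, but only one may
     be lost. *)
  have KE : pairs K \subset edges G.
    apply/setIidPr/eqP; rewrite eqEcard subsetIr cK /=.
    have half p x y : (2 * p <= x + y + 1 -> y <= x -> p <= x)%N by lia.
    exact: half heavy cH.
  rewrite KE /= => /dinjectivePn[e eK [f /andP[fe fK] ef]].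
  have {}fe : f != e by [].
  have {}fK : f \in pairs K by [].
  have few : (#|pairs K :\: rep_edges| <= 1)%N.
    rewrite cardsD setIC cK; move: heavy cE; rewrite cK.
    have diff p x y : (2 * p <= x + y + 1 -> x <= p -> p - y <= 1)%N by lia.
    exact: diff.
  have fE := subsetP KE _ fK; have eE := subsetP KE _ eK.
  have found g h : g \in pairs K -> h \in pairs K -> h != g ->
      color G g = color G h -> h \in rep_edges -> K \in \bigcup_(e in D) sup e.
    move=> gK hK hg gh hH; have gE := subsetP KE _ gK.
    have hr := rep_edges_eq gE hH gh.
    apply/bigcupP; exists g; first by rewrite inE gE -hr eq_sym.
    rewrite inE Kk /T -hr subUset andbT.
    by move: gK hK; rewrite !inE => /andP[-> _] /andP[-> _].
  (* One of the two equally colored edges is a representative, since at most one pair in [K] is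
     not. *)
  have [fH|fH] := boolP (f \in rep_edges); first exact: (found e f).
  have [eH|eH] := boolP (e \in rep_edges); first by apply: (found f e); rewrite // eq_sym.
  have : [set e; f] \subset pairs K :\: rep_edges.
    by rewrite subUset !sub1set !in_setD eH fH eK fK.
  by move/subset_leq_card; rewrite cards2 eq_sym fe leqNgt ltnS few.
apply: leq_trans (subset_leq_card bad_sub) _.
have sup_le e : e \in D -> (#|sup e| <= #|V| ^ (k - 3))%N.
  rewrite inE => /andP[eE ne]; apply: card_supersets => //.
  have pair2 g : g \in edges G -> #|g| = 2%N.
    by move/(subsetP (edges_pairs G)); rewrite inE => /andP[_ /eqP].
  have [rE _] := color_repP eE; rewrite ltnNge; apply/negP => T2.
  have eT : e = T e by apply/eqP; rewrite eqEcard subsetUl (pair2 _ eE).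
  have rT : color_rep e = T e by apply/eqP; rewrite eqEcard subsetUr (pair2 _ rE).
  by rewrite {1}eT -rT eqxx in ne.
apply: (@leq_trans (\sum_(e in D) #|V| ^ (k - 3))).
  apply: (big_ind2 (fun (A : {set {set V}}) n => #|A| <= n)%N) => //.
    by rewrite cards0.
  by move=> A m B n Am Bn; rewrite cardsU (leq_trans (leq_subr _ _)) // leq_add.
rewrite sum_nat_const (_ : k.-1 = 2 + (k - 3))%N; last by lia.
rewrite expnD leq_mul2r; apply/orP; right.
have DV : D \subset pairs [set: V].
  by apply: subset_trans (edges_pairs G); apply/subsetP => e; rewrite inE => /andP[].
rewrite (leq_trans (subset_leq_card DV)) // card_pairs cardsT; exact: leq_bin_expn.
Qed.

End Representatives.

(** * From weighted pairs to rainbow cliques *)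

Theorem theorem3 (R : realType) (k : nat) (eps : R)
  (hk : (3 <= k)%N) (heps : 0 < eps) :
  exists2 delta : R, 0 < delta &
  exists N : nat, forall n : nat, (N <= n)%N ->
  forall (V : finType) (C : eqType) (G : edge_colored_graph V C),
    #|V| = n ->
    (num_edges G)%:R + (num_colors G)%:R
      >= (1 + (k%:R - 3) / (k%:R - 2) + 2 * eps) * ('C(n, 2))%:R :> R ->
    (num_rainbow_cliques G k)%:R >= delta * n%:R ^+ k.
Proof.
case: k hk => [|[|[|m]]] // _.
pose c : R := (eps / 2) ^+ m.+2 * (eps / 4) ^+ m.+3 / (m.+3)`!%:R.
have c0 : 0 < c.
  have [e2 e4] : 0 < eps / 2 /\ 0 < eps / 4 by lra.
  by rewrite divr_gt0 ?ltr0n ?fact_gt0 // mulr_gt0 // exprn_gt0.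
(* There are at least [c * n^k] heavy sets; half of them is reserved for the non-rainbow ones. *)
exists (c / 2); first by rewrite divr_gt0.
exists (Num.bound (8 / eps + 6) + Num.bound (2 / c)).+1 => n Nn V C G Vn hG.
have big (x : R) : 0 <= x -> (Num.bound x <= n)%N -> x <= n%:R.
  by move=> x0 xn; rewrite (le_trans (ltW (archi_boundP x0))) // ler_nat.
have n_eps : 8 + 6 * eps <= eps * #|V|%:R.
  have : 8 / eps + 6 <= n%:R.
    by apply: big; [rewrite addr_ge0 ?divr_ge0 // ltW | lia].
  rewrite -(ler_pM2l heps) mulrDr mulrCA divff ?gt_eqF // mulr1 Vn.
  by rewrite [6 * _]mulrC.
have n_c : 2 <= c * n%:R.
  have : 2 / c <= n%:R by apply: big; [rewrite divr_ge0 // ltW | lia].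
  by rewrite ler_pdivrMr // mulrC.
have V0 : (0 < #|V|)%N by rewrite Vn; lia.
pose w (x y : V) : nat := (([set x; y] \in edges G) + ([set x; y] \in rep_edges G))%N.
have Epairs := edges_pairs G.
have Hpairs := subset_trans (rep_edges_sub G) Epairs.
have w_sym x y : w x y = w y x by rewrite /w setUC.
have w_irr x : w x x = 0%N.
  have nopair : [set x; x] \notin pairs [set: V] by rewrite inE setUid cards1 andbF.
  have notin (E : {set {set V}}) : E \subset pairs [set: V] -> ([set x; x] \in E) = false.
    by move=> /subsetP EP; apply: contraNF nopair => /EP.
  by rewrite /w !notin.
have w_le2 x y : (w x y <= 2)%N by rewrite /w; do 2!case: (_ \in _).
have weightE A : weight w A = (2 * (#|edges G :&: pairs A| + #|rep_edges G :&: pairs A|))%N.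
  rewrite mulnDr -!sum_ordered_pairs // -big_split; apply: eq_bigr => x _.
  by rewrite -big_split.
have bin2E j : (2 * 'C(j.+1, 2) = j.+1 * j)%N by rewrite -mul_bin_diag bin1.
(* Here [k - 2 = m.+1], so [1 + (k - 3) / (k - 2) = 2 - 1 / m.+1]. One [eps] enters the slope [a],
   the other is the surplus that makes [S] large. *)
have dense : (2 - m.+1%:R^-1 + eps + eps) * (#|V|%:R * (#|V|%:R - 1)) <=
    (weight w [set: V])%:R.
  rewrite weightE !(setIidPl _) // natrM.
  have := num_colors_le G; rewrite -(ler_nat R) => hc.
  have nn : #|V|%:R * (#|V|%:R - 1) = 2 * 'C(n, 2)%:R :> R.
    by rewrite Vn -natrM; case: (n) Nn => // j _; rewrite bin2E natrM -[X in X - 1]natr1 addrK.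
  have -> : 2 - m.+1%:R^-1 + eps + eps =
      1 + (m.+3%:R - 3) / (m.+3%:R - 2) + 2 * eps :> R.
    have -> : m.+3%:R - 2 = m.+1%:R :> R by rewrite -addn2 natrD addrK.
    have -> : m.+3%:R - 3 = m.+1%:R - 1 :> R.
      by rewrite -addn2 natrD -[3]natr1 opprD addrA addrK.
    rewrite mulrBl divff ?pnatr_eq0 // mul1r.
    by move: (_^-1) => y; lra.
  rewrite nn mulrCA ler_pM2l ?ltr0n // natrD.
  by apply: le_trans hG _; rewrite lerD2l.
have := weighted_supersaturation w_sym w_irr w_le2 heps erefl n_eps dense.
set heavy := [set K | _] => many.
have heavy_le : (#|heavy| <= num_rainbow_cliques G m.+3 + #|V| ^ m.+2)%N.
  apply: leq_trans (leq_add (leqnn _) (few_nonrainbow_cliques G (isT : 3 <= m.+3)%N V0)).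
  rewrite -cardsUI (leq_trans _ (leq_addr _ _)) //.
  apply/subset_leq_card/subsetP => K; rewrite !inE => /andP[-> hK] /=.
  case: (rainbow_clique _ _ _) => //=; rewrite andbT bin2E.
  move: hK; rewrite weightE -mulnA => hK.
  have half x y z : (2 * x - 2 <= 2 * (y + z) -> x <= y + z + 1)%N by lia.
  exact: half hK.
have heavy_ge : c * n%:R ^+ m.+3 <= #|heavy|%:R.
  rewrite /c mulrAC ler_pdivrMr ?ltr0n ?fact_gt0 // [leRHS]mulrC.
  by rewrite -mulrA -exprMn -Vn.
(* This is where [2 <= c * n] lets the reserved half absorb the [n^(k-1)] exceptions. *)
have small : n%:R ^+ m.+2 <= c / 2 * n%:R ^+ m.+3 :> R.
  rewrite (exprS _ m.+2) mulrA -[leLHS]mul1r ler_wpM2r ?exprn_ge0 //.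
  by rewrite mulrAC ler_pdivlMr // mul1r.
move: heavy_le; rewrite Vn -(ler_nat R) natrD natrX => heavy_le.
have : c * n%:R ^+ m.+3 <= (num_rainbow_cliques G m.+3)%:R + c / 2 * n%:R ^+ m.+3.
  by apply: le_trans heavy_ge (le_trans heavy_le _); rewrite lerD2l.
by move: (n%:R ^+ m.+3) (_ G _)%:R => x y; lra.
Qed.
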